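(* Let $(G,\cdot)$ be a group. 1) If $a\circ b = a\cdot b$ for all $a,b\in G$, then $(G,\cdot,\circ)$ is a skew brace. If $a\vdash b = a\dashv b = ab$ for all $a,b\in G$, then $(G,\dashv,\vdash)$ is a dimonoid. 2) If $a\circ b = ba$ for all $a,b\in G$, then $(G,\cdot,\circ)$ is a skew brace. If $a\vdash b = ab$ and $a\dashv b = ba$ for all $a,b\in G$, then $(G,\dashv,\vdash)$ is not a dimonoid.
   Context: Here $ab$ denotes the product $a\cdot b$ in the group $(G,\cdot)$. A triple $(G,\cdot,\circ)$, where $(G,\cdot)$ and $(G,\circ)$ are groups, is a skew (left) brace if $$g_1\circ(g_2\cdot g_3) = (g_1\circ g_2)\cdot g_1^{-1}\cdot(g_1\circ g_3)$$ for all $g_1,g_2,g_3\in G$, where $g_1^{-1}$ is the inverse of $g_1$ in $(G,\cdot)$. A dimonoid is a set $X$ with two binary operations $\vdash$ and $\dashv$ such that for all $x,y,z\in X$: $$x\dashv(y\dashv z) = (x\dashv y)\dashv z = x\dashv(y\vdash z),$$ $$(x\vdash y)\dashv z = x\vdash(y\dashv z),$$ $$(x\dashv y)\vdash z = x\vdash(y\vdash z) = (x\vdash y)\vdash z.$$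
   Formalization: The last claim of 2), that G with these operations is not a dimonoid, is stated only for non-commutative G; for every commutative group ab = ba and the claim is false by part 1). *)

(* Defs.v *)
From mathcomp Require Import all_boot.

Set Implicit Arguments.
Unset Strict Implicit.
Unset Printing Implicit Defensive.

Local Open Scope group_scope.

Definition is_group (T : Type) (op : T -> T -> T) : Prop :=
  associative op /\
  exists (e : T) (inv : T -> T),
    [/\ left_id e op, right_id e op, left_inverse e inv op
      & right_inverse e inv op].

(* The first operation of the brace is the multiplication of the group G;
   [circ] is the second one, on the same carrier. *)
Definition is_skew_brace (G : groupType) (circ : G -> G -> G) : Prop :=
  is_group circ /\
  forall g1 g2 g3 : G,
    circ g1 (g2 * g3) = circ g1 g2 * g1^-1 * circ g1 g3.

(* The operations come in the order of the triple (X, dashv, vdash). *)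
Definition is_dimonoid (X : Type) (dashv vdash : X -> X -> X) : Prop :=
  forall x y z : X,
    [/\ dashv x (dashv y z) = dashv (dashv x y) z,
        dashv (dashv x y) z = dashv x (vdash y z),
        dashv (vdash x y) z = vdash x (dashv y z),
        vdash (dashv x y) z = vdash x (vdash y z)
      & vdash x (vdash y z) = vdash (vdash x y) z].

(* Main.v *)
Require Import Defs.
From mathcomp Require Import all_boot.

Local Open Scope group_scope.

(** Opposite multiplication is a group law with the same unit and inverses, and
    in the brace identity the factor [g1^-1] cancels the [g1] standing beside
    it: on its right for [a * b], on its left for [b * a].  When both dimonoid
    operations are the product, every dimonoid axiom is associativity.  When
    [dashv] is the opposite product, the axiom
    [(x -| y) -| z = x -| (y |- z)] reads [z * (y * x) = (y * z) * x], which at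
    [x = 1] says that [y] and [z] commute; so a dimonoid would force [G] to be
    commutative. *)

(* The negative claim in 2) fails for commutative groups, where the two
   operations coincide; it is stated for noncommutative G. *)
Theorem proposition5p1 (G : groupType) :
  ((forall circ : G -> G -> G,
      (forall a b : G, circ a b = a * b) -> is_skew_brace circ) /\
   (forall dashv vdash : G -> G -> G,
      (forall a b : G, vdash a b = a * b) ->
      (forall a b : G, dashv a b = a * b) ->
      is_dimonoid dashv vdash)) /\
  ((forall circ : G -> G -> G,
      (forall a b : G, circ a b = b * a) -> is_skew_brace circ) /\
   ((exists a b : G, a * b <> b * a) ->
    forall dashv vdash : G -> G -> G,
      (forall a b : G, vdash a b = a * b) ->
      (forall a b : G, dashv a b = b * a) ->
      ~ is_dimonoid dashv vdash)).
Proof.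
split; split.
- move=> circ circE; split.
    split; first by move=> x y z; rewrite !circE mulgA.
    by exists 1, (fun x => x^-1); split=> x;
      rewrite circE ?mul1g ?mulg1 ?mulVg ?mulgV.
  by move=> g1 g2 g3; rewrite !circE !mulgA mulgVK.
- by move=> dashv vdash vE dE x y z; split; rewrite !(vE, dE) ?mulgA.
- move=> circ circE; split.
    split; first by move=> x y z; rewrite !circE mulgA.
    by exists 1, (fun x => x^-1); split=> x;
      rewrite circE ?mul1g ?mulg1 ?mulVg ?mulgV.
  by move=> g1 g2 g3; rewrite !circE mulgK mulgA.
- case=> a [b ab_neq] dashv vdash vE dE dimonoidG; apply: ab_neq.
  by have [_ + _ _ _] := dimonoidG 1 b a; rewrite !(vE, dE) !mulg1.
Qed.
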